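(* Let $K$ be a field of characteristic different from $2$ with $\zeta_4 \notin K$, let $a \in K^\times$, and let $m \geq n > 0$ be integers. If $K_4 \neq K_{2^\infty}$, let $s$ be the greatest integer such that $K_4 = K_{2^s}$. 1. If $a = b^{2^d}$ for some integer $d \geq 0$ and some $b \in K^\times$ strongly indivisible, then $$[K_{2^m}(\sqrt[2^n]{a}) : K_{2^m}] = 2^{\max(0, n-d)},$$ unless $K_4 \neq K_{2^\infty}$, $K(\sqrt{b}) \subseteq K_{2^\infty}$ and $m \geq s+1$, in which case $$[K_{2^m}(\sqrt[2^n]{a}) : K_{2^m}] = 2^{\max(0, n-d-1)}.$$ 2. If $a = -b^{2^d}$ for some integer $d > 0$ and some $b \in K^\times$ strongly indivisible, then $$[K_{2^m}(\sqrt[2^n]{a}) : K_{2^m}] = [K_{2^m}(\sqrt[2^n]{-a}) : K_{2^m}],$$ with the following exceptions: - if $m = n = 1$, then $[K(\sqrt{-a}) : K] = 1$ and $[K(\sqrt{a}) : K] = 2$; - if $K_4 \neq K_{2^\infty}$, $m = n \geq s$ and $[K_{2^m}(\sqrt[2^n]{-a}) : K_{2^m}] = 1$, then $[K_{2^m}(\sqrt[2^n]{a}) : K_{2^m}] = 2$; - if $K_4 \neq K_{2^\infty}$, $K(\sqrt{b}) \subseteq K_{2^\infty}$, $m = n = s = d+1$ and $[K_{2^m}(\sqrt[2^n]{-a}) : K_{2^m}] = 2$, then $[K_{2^m}(\sqrt[2^n]{a}) : K_{2^m}] = 1$.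
   Context: All fields are inside a fixed algebraic closure of $K$. For $k\ge1$, $\zeta_{2^k}$ is a primitive $2^k$-th root of unity, $K_{2^k} := K(\zeta_{2^k})$ and $K_{2^\infty} := \bigcup_{k \geq 1} K_{2^k}$. For $n\le m$ and $c\in K^\times$, $K_{2^m}(\sqrt[2^n]{c})$ is the field obtained by adjoining to $K_{2^m}$ a $2^n$-th root of $c$ (independent of the choice). An element $c \in K^\times$ is strongly indivisible (for $\ell=2$) if $c\xi$ is not a square in $K$ for every root of unity $\xi \in K$. *)

(* Defs.v *)
From mathcomp Require Export all_boot all_order all_algebra.
From mathcomp Require Export boolp classical_sets.

Set Implicit Arguments.
Unset Strict Implicit.
Unset Printing Implicit Defensive.

Import GRing.Theory.
Local Open Scope classical_set_scope.
Local Open Scope ring_scope.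

Definition is_subfield (L : fieldType) (E : set L) : Prop :=
  GRing.divring_closed [in E].

Definition adjoin (L : fieldType) (F S : set L) : set L :=
  smallest (@is_subfield L) (F `|` S).

Definition is_basis (L : fieldType) (F E : set L) (n : nat) (e : 'I_n -> L) :
    Prop :=
  (forall x, E x <->
     exists2 c : 'I_n -> L, (forall i, F (c i)) & x = \sum_i c i * e i) /\
  (forall c : 'I_n -> L, (forall i, F (c i)) ->
     \sum_i c i * e i = 0 -> forall i, c i = 0).

(* The degree [E : F], with the convention that it is 0 when E has no finite
   basis over F.                                                              *)
Definition degree (L : fieldType) (E F : set L) : nat :=
  xget 0%N [set n | exists e : 'I_n -> L, is_basis F E e].

(* K is identified with its image in L, and z k stands for a primitive 2^k-th
   root of unity (only the values for k >= 1 are ever used).                  *)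
Definition cyc2 (K L : fieldType) (iota : {rmorphism K -> L}) (z : nat -> L)
    (k : nat) : set L :=
  adjoin (range iota) [set z k].

Definition cyc2_inf (K L : fieldType) (iota : {rmorphism K -> L})
    (z : nat -> L) : set L :=
  \bigcup_(k in [set k | (1 <= k)%N]) cyc2 iota z k.

Definition strongly_indivisible (K : fieldType) (c : K) : Prop :=
  c != 0 /\
  forall (N : nat) (xi : K), (0 < N)%N -> N.-unity_root xi ->
    ~ exists y : K, c * xi = y ^+ 2.

(* Main.v *)
From HB Require Import structures.
Require Import Defs.
From mathcomp Require Import ring zify.

(* If zeta_4 is in M and x is a 2-power root of an element of M, then
   [M(x) : M] = 2^j with j least such that x^(2^j) is in M: the field M(x) is
   reached by successive square roots, each a genuine extension because e is never
   a square in M(e) for a quadratic e with e^2 in M.  For M = K_{2^m} and x a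
   2^n-th root of b^(2^d) the powers x^(2^(n-d)), x^(2^(n-d-1)) and x^(2^(n-d-2))
   are, up to roots of unity, b, sqrt b and a fourth root of b.  So everything
   reduces to three facts: sqrt b is not in K_4; if sqrt b is in K_{2^oo} then it
   is in K_{2^(s+1)}, the only quadratic extension of K_4 in the tower; no fourth
   root of b is in K_{2^oo}.  For the last one, an element of K_{2^oo} with a
   square in K_4 is a root of unity times an element of K_4, so a fourth root of b
   would give rho b = y^4 with rho a root of unity and y in K_4, and norms down to
   K give b^2 = +- N(y)^4, hence b = +- N(y)^2.  In the second case the roots of a
   and -a differ by a primitive 2^(n+1)-th root of unity, which lies in K_{2^m}
   unless m = n >= s and K_4 <> K_{2^oo}, or m = n = 1. *)

Set Implicit Arguments.
Unset Strict Implicit.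
Unset Printing Implicit Defensive.

Import GRing.Theory.
Local Open Scope classical_set_scope.
Local Open Scope ring_scope.

(** * Degrees over subfields *)

Section Dimension.
Variables (L : fieldType) (F : set L) (F_sub : is_subfield F).

Local Definition inF : {pred L} := [in F].

HB.instance Definition _ := GRing.isDivringClosed.Build L inF F_sub.

(** The set [F] is repackaged as a field type so that matrices with entries in it have a rank. *)
Local Definition subF : Type := {x : L | inF x}.

HB.instance Definition _ := [isSub of subF for @sval L inF].
HB.instance Definition _ := [Choice of subF by <:].
HB.instance Definition _ := [SubChoice_isSubIntegralDomain of subF by <:].
HB.instance Definition _ := [SubIntegralDomain_isSubField of subF by <:].

(** The coordinates of the [f j] in [e] form a q x p matrix over [F]. A row vector killing it is a
    linear relation between the [f j], so its rows are free and q is at most the number p of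
    columns. *)
Lemma basis_card_le (E : set L) (p q : nat) (e : 'I_p -> L) (f : 'I_q -> L) :
  is_basis F E e -> is_basis F E f -> (q <= p)%N.
Proof.
move=> [He _] [Hf Ff].
have F0 : F 0 by apply/set_mem; exact: (rpred0 inF).
have F1 : F 1 by apply/set_mem; exact: (rpred1 inF).
have fE j : exists c : 'I_p -> L, (forall i, F (c i)) /\ f j = \sum_i c i * e i.
  have /He[c Fc ->] : E (f j).
    apply/Hf; exists (fun i => (i == j)%:R) => [i|]; first by case: (i == j).
    rewrite (bigD1 j) //= eqxx mul1r big1 ?addr0 // => i /negPf->.
    by rewrite mul0r.
  by exists c.
have [A HA] := choice fE.
have AF i j : inF (A i j) by apply/mem_set; case: (HA i).
pose B : 'M[subF]_(q, p) := \matrix_(i, j) exist _ (A i j) (AF i j).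
suff /eqP <- : row_free B by exact: rank_leq_col.
apply: inj_row_free => v vB0; apply/rowP => j; rewrite mxE; apply: val_inj => /=.
apply: (Ff (fun i => val (v 0 i))); first by move=> i; apply/set_mem/valP.
rewrite (eq_bigr (fun i => \sum_k (val (v 0 i) * A i k) * e k)); last first.
  move=> i _; case: (HA i) => _ ->; rewrite mulr_sumr.
  by apply: eq_bigr => k _; rewrite mulrA.
rewrite exchange_big big1 //= => k _; rewrite -mulr_suml.
have /(congr1 (fun M : 'rV_p => val (M 0 k))) := vB0.
rewrite !mxE raddf_sum /= (eq_bigr (fun i => val (v 0 i) * A i k)).
  by move=> ->; rewrite mul0r.
by move=> i _; rewrite !mxE.
Qed.

Lemma degree_basis (E : set L) (p : nat) (e : 'I_p -> L) :
  is_basis F E e -> degree E F = p.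
Proof.
move=> He; apply: xget_unique; first by exists e.
move=> q [f Hf]; apply/eqP.
by rewrite eqn_leq (basis_card_le He Hf) (basis_card_le Hf He).
Qed.

End Dimension.

(** * Subfields, quadratic extensions and chains of square roots *)

Section Subfields.
Variable L : fieldType.
Implicit Types (F E S : set L) (x y u v e : L).

Lemma subfield1 F : is_subfield F -> F 1.
Proof. by case=> F1 _ _; apply: set_mem. Qed.

Lemma subfieldB F x y : is_subfield F -> F x -> F y -> F (x - y).
Proof. by case=> _ FB _ Fx Fy; apply/set_mem/FB; apply/mem_set. Qed.

Lemma subfield_div F x y : is_subfield F -> F x -> F y -> F (x / y).
Proof. by case=> _ _ FV Fx Fy; apply/set_mem/FV; apply/mem_set. Qed.

Lemma subfield0 F : is_subfield F -> F 0.
Proof. by move=> sF; rewrite -(subrr 1); apply: subfieldB => //; apply: subfield1. Qed.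

Lemma subfieldN F x : is_subfield F -> F x -> F (- x).
Proof. by move=> sF Fx; rewrite -sub0r; apply: subfieldB => //; apply: subfield0. Qed.

Lemma subfieldD F x y : is_subfield F -> F x -> F y -> F (x + y).
Proof.
by move=> sF Fx Fy; rewrite -[y]opprK; apply: subfieldB => //; apply: subfieldN.
Qed.

Lemma subfieldV F x : is_subfield F -> F x -> F x^-1.
Proof.
by move=> sF Fx; rewrite -div1r; apply: subfield_div => //; apply: subfield1.
Qed.

Lemma subfieldM F x y : is_subfield F -> F x -> F y -> F (x * y).
Proof.
by move=> sF Fx Fy; rewrite -[y]invrK; apply: subfield_div => //; apply: subfieldV.
Qed.

Lemma subfieldX F x n : is_subfield F -> F x -> F (x ^+ n).
Proof.
move=> sF Fx; elim: n => [|n IHn]; first by rewrite expr0; apply: subfield1.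
by rewrite exprS; apply: subfieldM.
Qed.

Lemma subfieldMl F x y : is_subfield F -> F x -> x != 0 -> F (x * y) -> F y.
Proof. by move=> sF Fx x0 Fxy; rewrite -[y](mulKf x0) mulrC; apply: subfield_div. Qed.

Ltac subfield_closed sF :=
  repeat first [assumption | lazymatch goal with
    | |- _ (_ + _) => apply: (subfieldD sF)
    | |- _ (- _) => apply: (subfieldN sF)
    | |- _ (_ * _) => apply: (subfieldM sF)
    | |- _ (_^-1) => apply: (subfieldV sF)
    | |- _ (_ ^+ _) => apply: (subfieldX _ sF)
    | |- _ 0 => exact: (subfield0 sF)
    | |- _ 1 => exact: (subfield1 sF)
    end].

Lemma is_subfieldP F : F 1 -> (forall x y, F x -> F y -> F (x - y)) ->
  (forall x y, F x -> F y -> F (x * y)) -> (forall x, F x -> F x^-1) ->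
  is_subfield F.
Proof.
move=> F1 FB FM FV; split; first exact/mem_set.
  by move=> x y /set_mem Fx /set_mem Fy; apply/mem_set/FB.
by move=> x y /set_mem Fx /set_mem Fy; apply/mem_set/FM => //; apply: FV.
Qed.

Lemma adjoin_subfield F S : is_subfield (adjoin F S).
Proof.
apply: is_subfieldP => [E [sE _]|x y Ex Ey E [sE FSE]|x y Ex Ey E [sE FSE]|x Ex E [sE FSE]].
- exact: subfield1.
- by apply: subfieldB => //; [apply: Ex|apply: Ey].
- by apply: subfieldM => //; [apply: Ex|apply: Ey].
- by apply: subfieldV => //; apply: Ex.
Qed.

Lemma sub_adjoin F S x : F x -> adjoin F S x.
Proof. by move=> Fx E [_ FSE]; apply: FSE; left. Qed.

Lemma adjoin1_id F x : adjoin F [set x] x.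
Proof. by move=> E [_ FSE]; apply: FSE; right. Qed.

Lemma adjoin1_sub F E x :
  is_subfield E -> (forall y, F y -> E y) -> E x -> adjoin F [set x] `<=` E.
Proof. by move=> sE FE Ex; apply: smallest_sub => // y [/FE|->]. Qed.

Lemma eq_set (E F : set L) :
  (forall x, E x -> F x) -> (forall x, F x -> E x) -> E = F.
Proof. by move=> EF FE; apply/seteqP; split. Qed.

Lemma adjoin_mem F x : is_subfield F -> F x -> adjoin F [set x] = F.
Proof.
move=> sF Fx; apply: eq_set => y; last exact: sub_adjoin.
exact: (adjoin1_sub sF).
Qed.

Lemma adjoin_mul F x w :
  is_subfield F -> F w -> w != 0 -> adjoin F [set w * x] = adjoin F [set x].
Proof.
move=> sF Fw w0; have sA S := adjoin_subfield F S.
apply: eq_set; apply: (adjoin1_sub (sA _)); try by move=> y; apply: sub_adjoin.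
  by apply: (subfieldM (sA _)); [apply: sub_adjoin|apply: adjoin1_id].
apply: (subfieldMl (sA _) _ w0); [exact: sub_adjoin|exact: adjoin1_id].
Qed.

(** If e lies outside [F], the set F + F e is itself a subfield, so it contains the smallest one; if
    e lies in [F], nothing is added to [F]. *)
Lemma adjoin_quadP F e : is_subfield F -> F (e ^+ 2) -> forall y,
  adjoin F [set e] y <-> exists u v, [/\ F u, F v & y = u + v * e].
Proof.
move=> sF Fe2 y; split; last first.
  have sA := adjoin_subfield F [set e].
  case=> u [v [Fu Fv ->]]; apply: (subfieldD sA); first exact: sub_adjoin.
  by apply: (subfieldM sA); [exact: sub_adjoin|exact: adjoin1_id].
have [Fe|nFe] := pselect (F e).
  rewrite adjoin_mem // => Fy; exists y, 0; split=> //; first exact: subfield0.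
  by rewrite mul0r addr0.
apply: (adjoin1_sub (E := [set y | exists u v, [/\ F u, F v & y = u + v * e]])) => /=.
- apply: is_subfieldP => /=.
  + exists 1, 0; split; [exact: subfield1|exact: subfield0|by rewrite mul0r addr0].
  + move=> _ _ [u [v [Fu Fv ->]]] [u' [v' [Fu' Fv' ->]]].
    exists (u - u'), (v - v'); split; [by subfield_closed sF|by subfield_closed sF|ring].
  + move=> _ _ [u [v [Fu Fv ->]]] [u' [v' [Fu' Fv' ->]]].
    exists (u * u' + v * v' * e ^+ 2), (u * v' + v * u').
    by split; [subfield_closed sF|subfield_closed sF|ring].
  + move=> _ [u [v [Fu Fv ->]]].
    have [->|v0] := eqVneq v 0.
      exists u^-1, 0; split; [exact: subfieldV|exact: subfield0|].
      by rewrite !mul0r !addr0.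
    have n1 : u + v * e != 0.
      apply: contra_notN nFe => /eqP uve.
      have -> : e = - u / v by rewrite (addr0_eq uve) mulrC mulKf.
      by subfield_closed sF.
    have n2 : u - v * e != 0.
      apply: contra_notN nFe => /eqP uve.
      have -> : e = u / v by move/subr0_eq: uve => ->; rewrite mulrC mulKf.
      by subfield_closed sF.
    have FD : F ((u + v * e) * (u - v * e)).
      have -> : (u + v * e) * (u - v * e) = u ^+ 2 - v ^+ 2 * e ^+ 2 by ring.
      by subfield_closed sF.
    (* The inverse is the conjugate u - v e divided by the norm, which is nonzero because e is not
       in [F]. *)
    exists (u / ((u + v * e) * (u - v * e))), (- v / ((u + v * e) * (u - v * e))).
    split; [by subfield_closed sF|by subfield_closed sF|].
    by field; rewrite n1 n2.
- move=> u Fu; exists u, 0; split=> //; [exact: subfield0|by rewrite mul0r addr0].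
- by exists 0, 1; split; [exact: subfield0|exact: subfield1|rewrite mul1r add0r].
Qed.

Lemma quad_free F e u v : is_subfield F -> ~ F e -> F u -> F v ->
  u + v * e = 0 -> u = 0 /\ v = 0.
Proof.
move=> sF nFe Fu Fv uve.
have v0 : v = 0.
  apply/eqP; apply: contra_notT nFe => v0.
  have -> : e = - u / v by rewrite (addr0_eq uve) mulrC mulKf.
  by subfield_closed sF.
by move: uve; rewrite v0 mul0r addr0.
Qed.

(* Comparing coordinates in [F(e) = F + F e], a square root of an element of F is
   either in F or a multiple of e. *)
Lemma quad_sqrt F e x : 2%:R != 0 :> L -> is_subfield F -> F (e ^+ 2) -> ~ F e ->
  adjoin F [set e] x -> F (x ^+ 2) -> ~ F x -> exists2 v, F v & x = v * e.
Proof.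
move=> two_neq0 sF Fe2 nFe /(adjoin_quadP sF Fe2)[u [v [Fu Fv ->]]] Fx nFx.
have := @quad_free F e (u ^+ 2 + v ^+ 2 * e ^+ 2 - (u + v * e) ^+ 2) (2%:R * u * v) sF nFe.
have F2 : F 2%:R by rewrite mulr2n; apply: subfieldD => //; apply: subfield1.
case=> //.
- by subfield_closed sF.
- by subfield_closed sF.
- ring.
move=> _ /eqP; rewrite !mulf_eq0 (negPf two_neq0) /=.
case/orP=> /eqP uv0; first by exists v => //; rewrite uv0 add0r.
by case: nFx; rewrite uv0 mul0r addr0.
Qed.

(* Otherwise [e = y^2 / c] with [y = u + v e] forces [u^2 = - v^2 e^2], so [e]
   would be [i u / v] up to sign. *)
Lemma quad_nonsquare F e i c y : is_subfield F -> F (e ^+ 2) -> ~ F e ->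
  F i -> i ^+ 2 = -1 -> F c -> c != 0 -> adjoin F [set e] y -> y ^+ 2 != c * e.
Proof.
move=> sF Fe2 nFe Fi i2 Fc c0 /(adjoin_quadP sF Fe2)[u [v [Fu Fv ->]]].
apply: contra_notN nFe => /eqP uve.
have := @quad_free F e (u ^+ 2 + v ^+ 2 * e ^+ 2) (2%:R * u * v - c) sF.
have F2 : F 2%:R by rewrite mulr2n; apply: subfieldD => //; apply: subfield1.
have [//|nFe] := pselect (F e); case=> //.
- by subfield_closed sF.
- by subfield_closed sF.
- by move/eqP: uve; rewrite -subr_eq0 => /eqP <-; ring.
move=> uv2 /eqP; rewrite subr_eq0 => /eqP cE.
have v0 : v != 0 by apply: contraNneq c0 => v0; rewrite -cE v0 mulr0.
have : (e - i * u / v) * (e + i * u / v) = 0.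
  have -> : (e - i * u / v) * (e + i * u / v) =
      (u ^+ 2 + v ^+ 2 * e ^+ 2) / v ^+ 2 - (i ^+ 2 + 1) * u ^+ 2 / v ^+ 2.
    by field.
  by rewrite uv2 i2 addNr !mul0r subr0.
have Fiuv : F (i * u / v) by subfield_closed sF.
move=> /eqP; rewrite mulf_eq0 subr_eq0 addr_eq0 => /orP[]/eqP -> //.
exact: subfieldN.
Qed.

(** The tower law for one quadratic step: the new basis consists of the [f i] followed by the
    [e * f i]. *)
Lemma basis_double F E e (p : nat) (f : 'I_p -> L) :
  is_subfield F -> F (e ^+ 2) -> ~ F e -> is_basis (adjoin F [set e]) E f ->
  exists g : 'I_(p + p) -> L, is_basis F E g.
Proof.
move=> sF Fe2 nFe [Ef ff].
exists (fun k => match split k with inl i => f i | inr i => e * f i end).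
have sumE (c : 'I_(p + p) -> L) :
    \sum_i c i * match split i with inl i => f i | inr i => e * f i end =
    \sum_i (c (lshift p i) + c (rshift p i) * e) * f i.
  rewrite big_split_ord /= -big_split /=; apply: eq_bigr => i _.
  by rewrite (unsplitK (inl i)) (unsplitK (inr i)) mulrDl mulrA.
split=> [x|c Fc].
  split=> [/Ef[c Fc ->]|[c Fc ->]].
    have /choice[uv uvP] i : exists uv : L * L, [/\ F uv.1, F uv.2 & c i = uv.1 + uv.2 * e].
      by have /(adjoin_quadP sF Fe2)[u [v uvP]] := Fc i; exists (u, v).
    exists (fun k => match split k with inl i => (uv i).1 | inr i => (uv i).2 end).
      by move=> k; case: (split k) => i; case: (uvP i).
    rewrite sumE; apply: eq_bigr => i _.
    by rewrite (unsplitK (inl i)) (unsplitK (inr i)); case: (uvP i) => _ _ <-.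
  rewrite sumE; apply/Ef.
  exists (fun i => c (lshift p i) + c (rshift p i) * e) => // i.
  by apply/(adjoin_quadP sF Fe2); exists (c (lshift p i)), (c (rshift p i)).
rewrite sumE => /ff c0 k.
have {}c0 i : c (lshift p i) = 0 /\ c (rshift p i) = 0.
  apply: (quad_free sF nFe) => //; apply: c0 => {}i.
  by apply/(adjoin_quadP sF Fe2); exists (c (lshift p i)), (c (rshift p i)).
by rewrite -[k]splitK; case: (split k) => i; case: (c0 i).
Qed.

(** The last power of x outside [F] is adjoined first; over this quadratic extension one squaring
    fewer remains, and induction applies. The condition on i starts at j = 2, so that the cases j <=
    1 also apply over K itself, which does not contain a fourth root of unity. *)
Lemma basis_adjoin_root F i x j : is_subfield F ->
  ((1 < j)%N -> F i) -> i ^+ 2 = -1 ->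
  F (x ^+ (2 ^ j)) -> ((0 < j)%N -> ~ F (x ^+ (2 ^ j.-1))) ->
  exists f : 'I_(2 ^ j) -> L, is_basis F (adjoin F [set x]) f.
Proof.
move=> sF + i2; elim: j F sF => [|j IHj] F sF Fi Fx nFx.
  exists (fun=> 1); rewrite adjoin_mem //; split=> [y|c Fc].
    split=> [Fy|[c Fc ->]]; last by rewrite big_ord1 mulr1.
    by exists (fun=> y); rewrite // big_ord1 mulr1.
  by rewrite big_ord1 mulr1 => c0 k; rewrite ord1.
have /= {}nFx := nFx isT.
set e := x ^+ (2 ^ j) in nFx.
have Fe2 : F (e ^+ 2) by rewrite -exprM -expnSr.
have sFe := adjoin_subfield F [set e].
have <- : adjoin (adjoin F [set e]) [set x] = adjoin F [set x].
  have sA E S := adjoin_subfield E S.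
  apply: eq_set; apply: (adjoin1_sub (sA _ _)); try exact: adjoin1_id.
    apply: (adjoin1_sub (sA _ _)); first by move=> y; apply: sub_adjoin.
    by apply: (subfieldX _ (sA _ _)); apply: adjoin1_id.
  by move=> y Fy; do 2!apply: sub_adjoin.
case: (IHj _ sFe).
- by move=> j1; apply: sub_adjoin; apply: Fi; apply: leqW.
- exact: adjoin1_id.
(* The next power of x is a square root of e, hence not in F(e) by [quad_nonsquare] with c = 1. *)
- case: j @e {IHj} Fi Fx nFx Fe2 sFe => // j e Fi Fx nFx Fe2 sFe _ Fxe.
  have := quad_nonsquare sF Fe2 nFx (Fi isT) i2 (subfield1 sF) (oner_neq0 _) Fxe.
  by rewrite mul1r -exprM -expnSr eqxx.
by move=> f /(basis_double sF Fe2 nFx); rewrite addnn -mul2n -expnS.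
Qed.

Lemma degree_adjoin_root F i x j : is_subfield F ->
  ((1 < j)%N -> F i) -> i ^+ 2 = -1 ->
  F (x ^+ (2 ^ j)) -> ((0 < j)%N -> ~ F (x ^+ (2 ^ j.-1))) ->
  degree (adjoin F [set x]) F = (2 ^ j)%N.
Proof.
move=> sF Fi i2 Fx nFx; have [f] := basis_adjoin_root sF Fi i2 Fx nFx.
exact: degree_basis.
Qed.

End Subfields.

(** * The tower of cyclotomic 2-extensions *)

Lemma strongly_indivisible_neq (K : fieldType) (b : K) :
  strongly_indivisible b -> forall y, b != y ^+ 2 /\ b != - y ^+ 2.
Proof.
case=> b0 nsq y; split; apply/eqP => bE.
  by apply: (nsq 1%N 1); rewrite ?unity_rootE ?expr1 //; exists y; rewrite mulr1.
apply: (nsq 2%N (-1)); rewrite ?unity_rootE ?sqrrN ?expr1n //.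
by exists y; rewrite bE mulrN1 opprK.
Qed.

Lemma closed_sqrt (L : closedFieldType) (x : L) : exists y, y ^+ 2 = x.
Proof.
have [y yE] := solve_monicpoly (fun i : nat => if i is 0%N then x else 0) (isT : 0 < 2)%N.
by exists y; rewrite yE !big_ord_recl big_ord0 /= expr0 mulr1 mul0r !addr0.
Qed.

(** * Primitive roots of unity of 2-power order *)

Section Roots.
Variables (L : fieldType) (two_neq0 : 2%:R != 0 :> L).

Lemma neg1_neq1 : -1 != 1 :> L.
Proof. by rewrite eq_sym -subr_eq0 opprK -mulr2n. Qed.

(** This replaces primitivity by an equation. The order divides 2^(k+1), and a proper divisor would
    divide 2^k, forcing -1 = 1. *)
Lemma prim_root_pow2 (x : L) k :
  (2 ^ k.+1).-primitive_root x <-> x ^+ (2 ^ k) = -1.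
Proof.
split=> [px|xk].
  have /eqP := prim_expr_order px.
  rewrite expnSr exprM -[X in _ == X](expr1n _ 2) eqf_sqr => /orP[|/eqP//].
  by rewrite -(prim_order_dvd px) dvdn_Pexp2l // ltnn.
have x1 : x ^+ (2 ^ k.+1) = 1 by rewrite expnSr exprM xk sqrrN expr1n.
have [n px] := prim_order_exists (expn_gt0 2 k.+1) x1.
move=> /dvdn_pfactor[]// j; rewrite leq_eqVlt ltnS => /orP[/eqP->|jk] nE.
  by rewrite -nE.
have := prim_order_dvd px (2 ^ k).
by rewrite nE dvdn_Pexp2l // jk xk (negPf neg1_neq1).
Qed.

End Roots.

(** * The layers of the tower, and coordinates in K_4 *)

Section Tower.
Variables (K : fieldType) (L : closedFieldType) (iota : {rmorphism K -> L}).
Variable z : nat -> L.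
Hypothesis two_neq0 : 2%:R != 0 :> L.
Hypothesis z_prim : forall k : nat, (1 <= k)%N -> (2 ^ k)%N.-primitive_root (z k).
Hypothesis z4_notin : ~ range iota (z 2%N).

Local Notation K0 := (range iota).
Local Notation Q := (cyc2 iota z).

Lemma range_subfield : is_subfield K0.
Proof.
apply: is_subfieldP.
- by exists 1; rewrite ?rmorph1.
- by move=> _ _ [x _ <-] [y _ <-]; exists (x - y); rewrite ?rmorphB.
- by move=> _ _ [x _ <-] [y _ <-]; exists (x * y); rewrite ?rmorphM.
- by move=> _ [x _ <-]; exists x^-1; rewrite ?fmorphV.
Qed.

Lemma cyc2_subfield k : is_subfield (Q k).
Proof. exact: adjoin_subfield. Qed.

Lemma cyc2_iota k x : Q k (iota x).
Proof. by apply: sub_adjoin; exists x. Qed.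

Lemma cyc2_unity k x : (0 < k)%N -> x ^+ (2 ^ k) = 1 -> Q k x.
Proof.
move=> k0 /(prim_rootP (z_prim k0))[i ->].
by apply: (subfieldX _ (cyc2_subfield k)); apply: adjoin1_id.
Qed.

Lemma cyc2_le j k x : (0 < j <= k)%N -> Q j x -> Q k x.
Proof.
case/andP=> j0 jk; move: x; apply: (adjoin1_sub (cyc2_subfield k)).
  exact: sub_adjoin.
apply: cyc2_unity; first exact: leq_trans jk.
by rewrite -(subnKC jk) expnD exprM (prim_expr_order (z_prim j0)) expr1n.
Qed.

(** The quotient x / y is a 2^j-th root of unity, so it already lies in K_{2^k}. *)
Lemma cyc2_root j k x y : (0 < k)%N -> (j <= k)%N ->
  x ^+ (2 ^ j) = y ^+ (2 ^ j) -> Q k y -> Q k x.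
Proof.
move=> k0 jk xy Qy; have [y0|y0] := eqVneq y 0.
  move/eqP: xy; rewrite y0 [0 ^+ _]expr0n expn_eq0 /= expf_eq0 => /andP[_ /eqP->].
  exact: (subfield0 (cyc2_subfield k)).
rewrite -[x](divfK y0); apply: (subfieldM (cyc2_subfield k)) => //.
apply: cyc2_unity => //.
by rewrite -(subnKC jk) expnD exprM expr_div_n xy divff ?expr1n // expf_neq0.
Qed.

Lemma z_pow k : z k.+1 ^+ (2 ^ k) = -1.
Proof. by apply/(prim_root_pow2 two_neq0); apply: z_prim. Qed.

Lemma cyc2_neg1 k w x : w ^+ (2 ^ k) = -1 -> x ^+ (2 ^ k) = -1 ->
  forall n, Q n w -> Q n x.
Proof.
move=> /(prim_root_pow2 two_neq0) /prim_rootP pw /(prim_root_pow2 two_neq0).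
move=> /prim_expr_order /pw[i ->] n.
exact: (subfieldX _ (cyc2_subfield n)).
Qed.

Lemma cyc2_step k w : (0 < k)%N -> w ^+ (2 ^ k) = -1 -> Q k.+1 = adjoin (Q k) [set w].
Proof.
move=> k0 wk; have sA := adjoin_subfield (Q k) [set w].
apply: eq_set.
  apply: (adjoin1_sub sA); first by move=> x K0x; do 2!apply: sub_adjoin.
  move: (z_pow k) => /(prim_root_pow2 two_neq0) /prim_expr_order.
  move/(prim_root_pow2 two_neq0)/prim_rootP: wk => wk /wk[i ->].
  by apply: (subfieldX _ sA); apply: adjoin1_id.
apply: (adjoin1_sub (cyc2_subfield _)); first by move=> x; apply: cyc2_le; rewrite k0 leqnSn.
by apply: cyc2_unity; rewrite // expnSr exprM wk sqrrN expr1n.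
Qed.

Lemma z2_sqr : z 2 ^+ 2 = -1.
Proof. exact: (z_pow 1). Qed.

Lemma cyc2_1 : Q 1 = K0.
Proof.
apply: (adjoin_mem range_subfield); exists (-1) => //.
by rewrite rmorphN1 -(z_pow 0) expr1.
Qed.

Lemma cyc2_2P x : Q 2 x <-> exists u v, x = iota u + iota v * z 2.
Proof.
have z2 : K0 (z 2 ^+ 2) by rewrite z2_sqr; exists (-1); rewrite ?rmorphN1.
split=> [/(adjoin_quadP range_subfield z2)|].
  by case=> _ [_ [[u _ <-] [v _ <-] ->]]; exists u, v.
by case=> u [v ->]; apply/(adjoin_quadP range_subfield z2); exists (iota u), (iota v).
Qed.

Lemma cyc2_2_inj u v u' v' :
  iota u + iota v * z 2 = iota u' + iota v' * z 2 -> u = u' /\ v = v'.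
Proof.
move=> /eqP; rewrite -subr_eq0.
have -> : iota u + iota v * z 2 - (iota u' + iota v' * z 2) =
  iota (u - u') + iota (v - v') * z 2 by rewrite !rmorphB; ring.
move=> /eqP /(quad_free range_subfield z4_notin)[]; [by exists (u - u')|by exists (v - v')|].
by move=> /eqP; rewrite fmorph_eq0 subr_eq0 => /eqP-> /eqP; rewrite fmorph_eq0 subr_eq0 => /eqP->.
Qed.

Lemma neg1_nonsquare (c : K) : c ^+ 2 != -1.
Proof.
apply: contra_notN z4_notin => /eqP /(congr1 iota).
rewrite rmorphXn rmorphN1 -z2_sqr => /eqP; rewrite eqf_sqr => /orP[]/eqP cE.
  by exists c.
by exists (- c); rewrite // rmorphN cE opprK.
Qed.

(** Square roots of 1 are extracted one at a time; the value -1 can only occur at the last step,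
    since it is not a square in K. *)
Lemma pow2_unity (c : K) k : c ^+ (2 ^ k) = 1 -> c = 1 \/ c = -1.
Proof.
elim: k => [|k IHk]; first by left; rewrite -[c]expr1.
rewrite expnSr exprM => /eqP; rewrite -[X in _ == X](expr1n _ 2) eqf_sqr.
case/orP=> /eqP // ck; case: k ck IHk => [|k] ck _; first by right; rewrite -[c]expr1.
by have := neg1_nonsquare (c ^+ (2 ^ k)); rewrite -exprM -expnSr ck eqxx.
Qed.

(** Multiplicativity of the norm from K_4 to K, in coordinates and for 2-power exponents. *)
Lemma pow2_norm k p q : exists P R,
  (iota p + iota q * z 2) ^+ (2 ^ k) = iota P + iota R * z 2 /\
  P ^+ 2 + R ^+ 2 = (p ^+ 2 + q ^+ 2) ^+ (2 ^ k).
Proof.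
elim: k p q => [|k IHk] p q; first by exists p, q; rewrite !expr1.
have [P [R [PE RE]]] := IHk (p ^+ 2 - q ^+ 2) (2%:R * p * q).
exists P, R; split; rewrite expnS exprM.
  rewrite -PE; congr (_ ^+ _); rewrite rmorphB !rmorphXn !rmorphM rmorph_nat /=.
  transitivity (iota p ^+ 2 + 2%:R * iota p * iota q * z 2 + iota q ^+ 2 * z 2 ^+ 2).
    by ring.
  by rewrite z2_sqr; ring.
by rewrite RE; congr (_ ^+ _); ring.
Qed.

(** * Strongly indivisible elements in K_4 *)

Section Indivisible.
Variable b : K.
Hypothesis b_ind : strongly_indivisible b.

(** If (u + v i)^2 = b then 2 u v = 0, so b is u^2 or -v^2, and both are excluded. *)
Lemma sqrt_notin rb : rb ^+ 2 = iota b -> ~ Q 2 rb.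
Proof.
move=> rbE /cyc2_2P[u [v rbuv]].
have : iota (u ^+ 2 - v ^+ 2) + iota (2%:R * u * v) * z 2 = iota b + iota 0 * z 2.
  rewrite -rbE rbuv rmorphB !rmorphXn !rmorphM rmorph_nat rmorph0 /= mul0r addr0.
  transitivity (iota u ^+ 2 - iota v ^+ 2 + 2%:R * iota u * iota v * z 2
    + iota v ^+ 2 * (z 2 ^+ 2 + 1)); last by ring.
  by rewrite z2_sqr addNr mulr0 addr0.
move=> /cyc2_2_inj[bE /eqP].
have two0 : 2%:R != 0 :> K by rewrite -(fmorph_eq0 iota) rmorph_nat.
have [b1 b2] := (strongly_indivisible_neq b_ind u, strongly_indivisible_neq b_ind v).
rewrite !mulf_eq0 (negPf two0) /= => /orP[]/eqP uv0.
  by case: b2 => _; rewrite -bE uv0 expr0n sub0r eqxx.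
by case: b1; rewrite -bE uv0 expr0n subr0 eqxx.
Qed.

(* Taking norms from K(i) to K in [rho b = y^4] gives [b^2 = +- N(y)^4]. *)
Lemma unity_mul_neq_pow4 (rho y : L) k :
  rho ^+ (2 ^ k) = 1 -> Q 2 rho -> Q 2 y -> rho * iota b <> y ^+ 4.
Proof.
move=> rhok /cyc2_2P[p [q rhoE]] /cyc2_2P[u [v yE]] rbE.
have [P [R [PE RE]]] := pow2_norm k p q.
have [A [B [AE BE]]] := pow2_norm 2 u v.
have [P1 R0] : P = 1 /\ R = 0.
  by apply: cyc2_2_inj; rewrite -PE -rhoE rhok rmorph1 rmorph0 mul0r addr0.
have [Ab Bb] : p * b = A /\ q * b = B.
  apply: cyc2_2_inj; rewrite -AE -yE -[(2 ^ 2)%N]/4%N -rbE rhoE !rmorphM; ring.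
have bN : (p ^+ 2 + q ^+ 2) * b ^+ 2 = (u ^+ 2 + v ^+ 2) ^+ 4.
  by rewrite -[4%N]/(2 ^ 2)%N -BE -Ab -Bb; ring.
have b0 : b != 0 by case: b_ind.
case: (pow2_unity (c := p ^+ 2 + q ^+ 2) (k := k)) => [|N1|N1].
- by rewrite -RE P1 R0 expr1n expr0n addr0.
- move/eqP: bN; rewrite N1 mul1r -[4%N]/(2 * 2)%N exprM eqf_sqr.
  by case: (strongly_indivisible_neq b_ind (u ^+ 2 + v ^+ 2)) => /negPf-> /negPf->.
- have := neg1_nonsquare ((u ^+ 2 + v ^+ 2) ^+ 2 / b).
  by rewrite expr_div_n -exprM -bN N1 mulfK ?expf_neq0 // eqxx.
Qed.

End Indivisible.

(** * The tower above level s when it does not stop at K_4 *)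

Section Nontrivial.
Variable s : nat.
Hypothesis s_ge2 : (2 <= s)%N.
Hypothesis Q_s : Q 2 = Q s.
Hypothesis z_notin : ~ Q s (z s.+1).

(** Once the tower grows it grows at every level: w^2 generates a quadratic extension of the layer
    below and so has no square root in it. *)
Lemma z_new t w : (s <= t)%N -> w ^+ (2 ^ t) = -1 -> ~ Q t w.
Proof.
elim: t w => [|t IHt] w; first by rewrite leqNgt (ltn_trans _ s_ge2).
rewrite leq_eqVlt ltnS => /orP[/eqP <-|st] wt.
  by move=> Qw; apply: z_notin; apply: (cyc2_neg1 wt) Qw; apply: z_pow.
have t0 : (0 < t)%N by rewrite (leq_trans _ st) // (ltn_trans _ s_ge2).
have et : (w ^+ 2) ^+ (2 ^ t) = -1 by rewrite -exprM -expnS.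
have e2 : Q t ((w ^+ 2) ^+ 2).
  by apply: cyc2_unity; rewrite // exprAC et sqrrN expr1n.
have Qi : Q t (z 2) by apply: (@cyc2_le 2); [rewrite (leq_trans s_ge2)|apply: adjoin1_id].
rewrite (cyc2_step t0 et) => Qw.
have := quad_nonsquare (cyc2_subfield t) e2 (IHt _ st et) Qi z2_sqr
  (subfield1 (cyc2_subfield t)) (oner_neq0 _) Qw.
by rewrite mul1r eqxx.
Qed.

(** Otherwise x = v w with w = z_{t+2} and v in K_{2^(t+1)}. Then v^2 is a nonzero element of
    K_{2^t} times w^2, the generator of K_{2^(t+1)} over K_{2^t}, contradicting [quad_nonsquare]. *)
Lemma sqrt_descend t x : (s <= t)%N -> Q t.+2 x -> Q t (x ^+ 2) -> Q t.+1 x.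
Proof.
move=> st Qx Qx2; have [//|nQx] := pselect (Q t.+1 x).
have t0 : (0 < t)%N by rewrite (leq_trans _ st) // (ltn_trans _ s_ge2).
set w := z t.+2; have wt : w ^+ (2 ^ t.+1) = -1 by apply: z_pow.
have et : (w ^+ 2) ^+ (2 ^ t) = -1 by rewrite -exprM -expnS.
have Qe : Q t.+1 (w ^+ 2) by apply: cyc2_unity; rewrite // expnSr exprM et sqrrN expr1n.
have Qe2 : Q t ((w ^+ 2) ^+ 2).
  by apply: cyc2_unity; rewrite // exprAC et sqrrN expr1n.
have Qi : Q t (z 2) by apply: (@cyc2_le 2); [rewrite (leq_trans s_ge2)|apply: adjoin1_id].
have nQw : ~ Q t.+1 w by apply: z_new => //; apply: leqW.
have Qx2' : Q t.+1 (x ^+ 2) by apply: cyc2_le Qx2; rewrite t0 leqnSn.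
move: Qx; rewrite (cyc2_step _ wt) // => Qx.
have [v Qv xE] := quad_sqrt two_neq0 (cyc2_subfield _) Qe nQw Qx Qx2' nQx.
have x0 : x != 0.
  by apply: contra_notN nQx => /eqP ->; apply: (subfield0 (cyc2_subfield _)).
have w0 : w != 0 by apply: contraNneq x0 => w0; rewrite xE w0 mulr0.
move: Qv; rewrite (cyc2_step t0 et) => Qv.
have /eqP[] : v ^+ 2 != x ^+ 2 / (w ^+ 2) ^+ 2 * w ^+ 2.
  apply: (quad_nonsquare (cyc2_subfield t) Qe2 (z_new st et) Qi z2_sqr _ _ Qv).
    exact: (subfield_div (cyc2_subfield t)).
  by rewrite mulf_neq0 ?invr_eq0 ?expf_neq0.
by rewrite xE; field.
Qed.

Lemma sqrt_in_succ t x : Q t x -> (0 < t)%N -> Q s (x ^+ 2) -> Q s.+1 x.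
Proof.
move=> Qx t0 Qx2; have : Q (s.+1 + t) x by apply: cyc2_le Qx; rewrite t0 leq_addl.
elim: t {Qx t0} => [|t IHt]; first by rewrite addn0.
rewrite addnS addSn => Qx; apply: IHt; rewrite addSn.
apply: sqrt_descend Qx _; first exact: leq_addr.
by apply: cyc2_le Qx2; rewrite leq_addr (ltn_trans _ s_ge2).
Qed.

(** Both w and x generate the same quadratic extension of K_{2^n}, so x is a multiple v w with v in
    the base, and w x = v w^2. *)
Lemma sqrt_mul_root n w x : (s <= n)%N -> w ^+ (2 ^ n) = -1 ->
  Q n.+1 x -> Q n (x ^+ 2) -> ~ Q n x -> Q n (w * x).
Proof.
move=> sn wn Qx Qx2 nQx.
have n0 : (0 < n)%N by rewrite (leq_trans _ sn) // (ltn_trans _ s_ge2).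
have Qw2 : Q n (w ^+ 2) by apply: cyc2_unity; rewrite // exprAC wn sqrrN expr1n.
move: Qx; rewrite (cyc2_step n0 wn) => Qx.
have [v Qv ->] := quad_sqrt two_neq0 (cyc2_subfield n) Qw2 (z_new sn wn) Qx Qx2 nQx.
rewrite mulrCA -expr2; exact: (subfieldM (cyc2_subfield n)).
Qed.

End Nontrivial.

Definition tower_stable : Prop := forall t, (2 <= t)%N -> Q t = Q 2.

Definition tower_breaks (s : nat) : Prop := [/\ (2 <= s)%N, Q 2 = Q s & ~ Q s (z s.+1)].

(** * Fourth roots of b and the degree of an iterated root *)

Section FourthRoot.
Variable s : nat.
Hypothesis tower_cases : tower_stable \/ tower_breaks s.

Lemma sqrt_up_to_unity t x : (0 < t)%N -> Q t x -> Q 2 (x ^+ 2) ->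
  exists k w, w ^+ (2 ^ k) = 1 /\ Q 2 (w * x).
Proof.
move=> t0 Qx Qx2; have [Q2x|nQ2x] := pselect (Q 2 x).
  by exists 0%N, 1; rewrite expr1n mul1r.
case: tower_cases => [st|[s2 Qs zs]].
  case: nQ2x; rewrite -(st t.+2) //; apply: cyc2_le Qx.
  by rewrite t0 (leq_trans (leqnSn t)).
exists s.+1, (z s.+1); rewrite expnSr exprM z_pow sqrrN expr1n; split=> //.
rewrite Qs in Qx2 nQ2x *.
apply: (sqrt_mul_root s2 zs (leqnn s) (z_pow s) _ Qx2 nQ2x).
exact: (sqrt_in_succ s2 zs Qx).
Qed.

(** [sqrt_up_to_unity] is used twice: it gives w with w x^2 in K_4, then, for r a square root of w,
    it gives v with v r x in K_4. So rho = (v r)^4 would make rho b a fourth power in K_4. *)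
Lemma fourth_root_notin b t x : strongly_indivisible b -> (0 < t)%N ->
  x ^+ 4 = iota b -> ~ Q t x.
Proof.
move=> b_ind t0 xb Qx.
have [||k [w [wk Qw]]] := @sqrt_up_to_unity t (x ^+ 2) t0.
- exact: (subfieldX _ (cyc2_subfield t)).
- by rewrite -exprM xb; apply: cyc2_iota.
have [r rw] := closed_sqrt w.
have rk : r ^+ (2 ^ k.+1) = 1 by rewrite expnS exprM rw.
have [|||l [v [vl Qv]]] := @sqrt_up_to_unity (t + k.+1) (r * x).
- by rewrite addnS.
- apply: (subfieldM (cyc2_subfield _)).
    by apply: (@cyc2_le k.+1); [rewrite leq_addl|apply: cyc2_unity].
  by apply: cyc2_le Qx; rewrite t0 leq_addr.
- by rewrite exprMn rw.
have b0 : iota b != 0 by case: b_ind => b0 _; rewrite fmorph_eq0.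
have E : (v * r) ^+ 4 * iota b = (v * (r * x)) ^+ 4 by rewrite -xb; ring.
apply: (unity_mul_neq_pow4 b_ind (k := (l + k.+1)%N) _ _ Qv E).
  rewrite exprAC exprMn {1}expnD exprM vl expr1n mul1r.
  by rewrite addnC expnD exprM rk !expr1n.
rewrite -[X in Q 2 X](mulfK b0) E; apply: (subfield_div (cyc2_subfield 2)).
  exact: (subfieldX _ (cyc2_subfield 2)).
exact: cyc2_iota.
Qed.

(** The power of x with exponent 2^(N-D-1) is sqrt b up to a 2^(D+1)-th root of unity, which lies in
    K_{2^m} because D < m. N is not bounded by m, so that 2^(n+1)-th roots can be treated when m =
    n. *)
Lemma degree_iterated_root m N D b rb x : (2 <= m)%N -> (D < N)%N -> (D < m)%N ->
  strongly_indivisible b -> rb ^+ 2 = iota b -> x ^+ (2 ^ N) = iota b ^+ (2 ^ D) ->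
  (Q m rb -> degree (adjoin (Q m) [set x]) (Q m) = (2 ^ (N - D - 1))%N) /\
  (~ Q m rb -> degree (adjoin (Q m) [set x]) (Q m) = (2 ^ (N - D))%N).
Proof.
move=> m2 DN Dm b_ind rb2 xN; have m0 : (0 < m)%N by apply: ltnW.
have Qi : Q m (z 2) by apply: (@cyc2_le 2); rewrite ?m2 //; apply: adjoin1_id.
have [e NE] : exists e, (N = e.+1 + D)%N by exists (N - D.+1)%N; rewrite addSnnS subnK.
have rbD : rb ^+ (2 ^ D.+1) = iota b ^+ (2 ^ D) by rewrite expnS exprM rb2.
have xe : (x ^+ (2 ^ e)) ^+ (2 ^ D.+1) = rb ^+ (2 ^ D.+1).
  by rewrite rbD -xN -exprM -expnD NE addSnnS.
have -> : (N - D)%N = e.+1 by rewrite NE addnK.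
rewrite subn1 /=.
have sQ := cyc2_subfield m.
split=> rbQ; apply: (degree_adjoin_root sQ (fun=> Qi) z2_sqr).
- exact: (cyc2_root m0 Dm xe).
- case: e {NE} xe => // e xe _ /= Qx.
  (* r is a fourth root of b, equal to this power of x up to a 2^(D+2)-th root of unity; level m + D
     + 2 contains both. *)
  have [r r2] := closed_sqrt rb.
  apply: (@fourth_root_notin b (m + D.+2) r b_ind).
  + by rewrite addnS.
  + by rewrite -[4%N]/(2 * 2)%N exprM r2.
  have xr : r ^+ (2 ^ D.+2) = (x ^+ (2 ^ e)) ^+ (2 ^ D.+2).
    by rewrite [in LHS]expnS exprM r2 -xe -!exprM -!expnD addSnnS.
  apply: (cyc2_root _ _ xr); rewrite ?addnS ?ltnS ?leq_addl //.
  by apply: cyc2_le Qx; rewrite m0 -!addnS leq_addr.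
- apply: (@cyc2_root D _ _ (iota b)); rewrite ?(ltnW Dm) //; last exact: cyc2_iota.
  by rewrite -xN NE expnD exprM.
- by move=> _ /= Qx; apply: rbQ; apply: (cyc2_root m0 Dm (esym xe)).
Qed.

End FourthRoot.
End Tower.

(** * Degrees of the roots of a and of -a *)

Theorem theorem13 (K : fieldType) (L : closedFieldType)
    (iota : {rmorphism K -> L})
    (L_alg : forall x : L, algebraicOver iota x)
    (K_char : (2 \notin [pchar K])%N)
    (z : nat -> L)
    (z_prim : forall k : nat, (1 <= k)%N -> (2 ^ k)%N.-primitive_root (z k))
    (z4_notin : ~ range iota (z 2%N))
    (a : K) (a_neq0 : a != 0)
    (m n : nat) (n_gt0 : (0 < n)%N) (n_le_m : (n <= m)%N)
    (s : nat)
    (s_max : cyc2 iota z 2%N <> cyc2_inf iota z ->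
       [/\ (1 <= s)%N, cyc2 iota z 2%N = cyc2 iota z s &
           forall t : nat, (1 <= t)%N -> cyc2 iota z 2%N = cyc2 iota z t ->
             (t <= s)%N])
    (* a 2^n-th root of a, and a 2^n-th root of -a *)
    (ra : L) (ra_root : ra ^+ (2 ^ n) = iota a)
    (rNa : L) (rNa_root : rNa ^+ (2 ^ n) = iota (- a)) :
  let K0 := range iota in
  let Km := cyc2 iota z m in
  let Kinf := cyc2_inf iota z in
  let deg_a := degree (adjoin Km [set ra]) Km in
  let deg_Na := degree (adjoin Km [set rNa]) Km in
  (forall (d : nat) (b : K) (rb : L),
      strongly_indivisible b -> rb ^+ 2 = iota b ->
      a = b ^+ (2 ^ d) ->
      let exceptional :=
        [/\ cyc2 iota z 2%N <> Kinf, adjoin K0 [set rb] `<=` Kinf &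
            (s + 1 <= m)%N] in
      (~ exceptional -> deg_a = (2 ^ (n - d))%N) /\
      (exceptional -> deg_a = (2 ^ (n - d - 1))%N))
  /\
  (forall (d : nat) (b : K) (rb : L),
      (0 < d)%N ->
      strongly_indivisible b -> rb ^+ 2 = iota b ->
      a = - b ^+ (2 ^ d) ->
      let exc1 := m = 1%N /\ n = 1%N in
      let exc2 :=
        [/\ cyc2 iota z 2%N <> Kinf, m = n, (s <= n)%N & deg_Na = 1%N] in
      let exc3 :=
        [/\ cyc2 iota z 2%N <> Kinf, adjoin K0 [set rb] `<=` Kinf,
            [/\ m = n, n = s & s = (d + 1)%N] & deg_Na = 2%N] in
      [/\ ~ exc1 -> ~ exc2 -> ~ exc3 -> deg_a = deg_Na,
          exc1 -> degree (adjoin K0 [set rNa]) K0 = 1%N /\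
                  degree (adjoin K0 [set ra]) K0 = 2%N,
          exc2 -> deg_a = 2%N &
          exc3 -> deg_a = 1%N]).
Proof.
have two_neq0 : 2%:R != 0 :> L.
  rewrite -(rmorph_nat iota) fmorph_eq0.
  by apply: contra K_char => two0; rewrite inE /= two0.
move=> K0 Km Kinf deg_a deg_Na.
have m_gt0 : (0 < m)%N by apply: leq_trans n_le_m.
have sQ k : is_subfield (cyc2 iota z k) := cyc2_subfield iota z k.
have z2 := z2_sqr two_neq0 z_prim.
(* Maximality of s is applied to t = 2, giving s >= 2, and to t = s + 1, showing that z_{s+1} is
   new. *)
have dichotomy : cyc2 iota z 2%N = Kinf /\ tower_stable iota z \/
    cyc2 iota z 2%N <> Kinf /\ tower_breaks iota z s.
  have [QK|QK] := pselect (cyc2 iota z 2%N = Kinf); [left|right]; split=> //.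
    move=> t t2; apply: eq_set => x; first by rewrite QK; exists t => //=; apply: ltnW.
    by apply: (cyc2_le z_prim); rewrite t2.
  have [s1 Qs smax] := s_max QK; split=> //; first exact: smax.
  move=> Qz; have /smax : cyc2 iota z 2%N = cyc2 iota z s.+1; last by rewrite ltnn => /(_ isT).
  have s2 : (2 <= s)%N by apply: smax.
  apply: eq_set; first by move=> x; apply: (cyc2_le z_prim); rewrite leqW.
  rewrite Qs; apply: adjoin1_sub => //; exact: sub_adjoin.
have cases : tower_stable iota z \/ tower_breaks iota z s by case: dichotomy; [left|right]; tauto.
have degree1 x : Km x -> degree (adjoin Km [set x]) Km = 1%N.
  move=> Kx; apply: (@degree_adjoin_root _ _ (z 2%N) x 0) => //; exact: sQ.
have degree2 x : Km (x ^+ 2) -> ~ Km x -> degree (adjoin Km [set x]) Km = 2%N.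
  move=> Kx nKx; apply: (@degree_adjoin_root _ _ (z 2%N) x 1) => //; exact: sQ.
have sub_Kinf rb : adjoin K0 [set rb] `<=` Kinf <->
    exists2 t, (0 < t)%N & cyc2 iota z t rb.
  split=> [/(_ rb (@adjoin1_id _ _ _))[t]|[t t0 Qrb] x Kx]; first by exists t.
  exists t => //; move: x Kx; apply: adjoin1_sub => //; exact: sub_adjoin.
have Km_root x b d : (n <= d)%N -> x ^+ (2 ^ n) = iota b ^+ (2 ^ d) -> Km x.
  move=> nd xb; apply: (cyc2_root z_prim m_gt0 n_le_m (y := iota b ^+ (2 ^ (d - n)))).
    by rewrite xb -exprM -expnD subnK.
  by rewrite -rmorphXn; apply: cyc2_iota.
(* For m >= 2 the exceptional condition says exactly that sqrt b lies in K_{2^m}. *)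
have sqrt_exceptional b rb : (2 <= m)%N -> strongly_indivisible b -> rb ^+ 2 = iota b ->
    Km rb <-> [/\ cyc2 iota z 2%N <> Kinf, adjoin K0 [set rb] `<=` Kinf & (s + 1 <= m)%N].
  move=> m2 b_ind rb2; have nQrb := sqrt_notin two_neq0 z_prim z4_notin b_ind rb2.
  rewrite addn1; split=> [Kmrb|[QK /sub_Kinf[t t0 Qrb] sm]].
    case: dichotomy => [[_ st]|[QK [s2 Qs _]]]; first by case: nQrb; rewrite -(st m).
    split=> //; first by apply/sub_Kinf; exists m.
    rewrite ltnNge; apply/negP => ms; apply: nQrb; rewrite Qs.
    by apply: (cyc2_le z_prim _ Kmrb); rewrite m_gt0.
  case: dichotomy => -[//] _ [s2 Qs zs].
  apply: (cyc2_le z_prim (j := s.+1)) => //.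
  apply: (sqrt_in_succ two_neq0 z_prim s2 zs Qrb t0).
  by rewrite rb2; apply: cyc2_iota.
split=> [d b rb b_ind rb2 ab exceptional|d b rb d0 b_ind rb2 ab exc1 exc2 exc3].
  have rab : ra ^+ (2 ^ n) = iota b ^+ (2 ^ d) by rewrite ra_root ab rmorphXn.
  (* For n <= d both formulas give 2^0, by truncated subtraction. *)
  have [nd|dn] := leqP n d.
    have /degree1 da := Km_root _ _ _ nd rab.
    by rewrite /deg_a da !(eqP nd) sub0n.
  have dm : (d < m)%N := leq_trans dn n_le_m.
  have [m2|] := leqP 2 m.
    have [da1 da2] := degree_iterated_root two_neq0 z_prim z4_notin cases m2 dn dm b_ind rb2 rab.
    by split=> [nexc|exc]; [apply: da2|apply: da1]; rewrite -/Km (sqrt_exceptional b).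
  (* Here n = 1 and d = 0, so [ra] is a square root of b; the exception would need s + 1 <= 1. *)
  rewrite ltnS => m1; have m1E : m = 1%N by lia.
  have [n1 d0] : n = 1%N /\ d = 0%N by lia.
  split=> [_|[QK _]]; last by case: dichotomy => -[//] _ [s2 _ _]; lia.
  rewrite n1 d0; apply: degree2.
    by move: rab; rewrite n1 d0 expr1 => ->; apply: cyc2_iota.
  move=> Kra; apply: (sqrt_notin two_neq0 z_prim z4_notin b_ind (rb := ra)).
    by move: rab; rewrite n1 d0 expr1.
  by apply: (cyc2_le z_prim _ Kra); rewrite m1E.
have rNab : rNa ^+ (2 ^ n) = iota b ^+ (2 ^ d) by rewrite rNa_root ab opprK rmorphXn.
have b0 : iota b != 0 by rewrite fmorph_eq0; case: b_ind.
have rNa0 : rNa != 0.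
  apply: contraNneq b0 => rNa0; move/eqP: rNab.
  by rewrite rNa0 expr0n expn_eq0 /= eq_sym expf_eq0 => /andP[].
(* w is a primitive 2^(n+1)-th root of unity; the two extensions coincide as soon as it lies in
   K_{2^m}. *)
pose w := ra / rNa; have raE : ra = w * rNa by rewrite divfK.
have wn : w ^+ (2 ^ n) = -1.
  rewrite expr_div_n ra_root rNa_root rmorphN invrN mulrN divff //.
  by rewrite fmorph_eq0.
have w0 : w != 0.
  by apply/eqP => w0; move/eqP: wn; rewrite w0 expr0n expn_eq0 /= eq_sym oppr_eq0 oner_eq0.
have same : Km w -> deg_a = deg_Na by move=> Kw; rewrite /deg_a raE adjoin_mul //; apply: sQ.
have w_unity : w ^+ (2 ^ n.+1) = 1 by rewrite expnSr exprM wn sqrrN expr1n.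
have Qw : cyc2 iota z n.+1 w by apply: (cyc2_unity z_prim).
move: n_le_m; rewrite leq_eqVlt => /orP[/eqP nm|nm]; last first.
  have e1 : ~ exc1 by move=> [mE nE]; lia.
  have e2 : ~ exc2 by move=> [_ mE _ _]; lia.
  have e3 : ~ exc3 by move=> [_ _ [mE _ _] _]; lia.
  split=> // _ _ _; apply: same; exact: (cyc2_le z_prim _ Qw).
have [n2|n1] := leqP 2 n; last first.
  have {}n1 : n = 1%N by lia.
  have n2E : (2 ^ n)%N = 2%N by rewrite n1.
  have KN : Km rNa by apply: Km_root rNab; rewrite n1.
  have e2 : ~ exc2 by move=> [QK _ sn _]; case: dichotomy => -[//] _ [s2 _ _]; lia.
  have e3 : ~ exc3 by move=> [QK _ [_ ns _] _]; case: dichotomy => -[//] _ [s2 _ _]; lia.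
  have K0E : Km = K0 by rewrite /Km -nm n1 cyc2_1.
  split=> // [e1|_]; first by case: e1; split; lia.
  rewrite -K0E; split; first exact: degree1.
  apply: degree2; first by rewrite -n2E ra_root; apply: cyc2_iota.
  move=> Kra; have : Km w by apply: (subfield_div (sQ m) Kra KN).
  rewrite K0E => -[c _ cw]; have /eqP[] := neg1_nonsquare two_neq0 z_prim z4_notin c.
  apply: (fmorph_inj iota); rewrite rmorphXn rmorphN1 /= cw.
  by rewrite -n2E.
have e1 : ~ exc1 by move=> [_ nE]; lia.
case: dichotomy => [[QK st]|[QK [s2 Qs zs]]].
  have e2 : ~ exc2 by case.
  have e3 : ~ exc3 by case.
  split=> // _ _ _; apply: same; rewrite /Km -nm.
  by rewrite st // -(st n.+1) ?leqW.
(* For n < s the root w lies in K_{2^s} = K_4, which is contained in K_{2^n}. *)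
have [sn|ns] := leqP s n; last first.
  have e2 : ~ exc2 by move=> [_ _ sn _]; lia.
  have e3 : ~ exc3 by move=> [_ _ [_ ns' _] _]; lia.
  split=> // _ _ _; apply: same; rewrite /Km -nm.
  apply: (cyc2_le z_prim (j := 2%N)); first by rewrite n2.
  by rewrite Qs; apply: (cyc2_le z_prim _ Qw).
have nKw : ~ Km w by rewrite /Km -nm; apply: (z_new two_neq0 z_prim s2 zs sn).
have Kw2 : Km (w ^+ 2).
  by rewrite /Km -nm; apply: cyc2_unity => //; rewrite exprAC wn sqrrN expr1n.
have m2 : (2 <= m)%N by rewrite -nm.
have [nd|dn] := leqP n d.
  have KN := Km_root _ _ _ nd rNab.
  have dN : deg_Na = 1%N by apply: degree1.
  have da : deg_a = 2%N.
    apply: degree2.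
      by rewrite raE exprMn; apply: (subfieldM (sQ m) Kw2); apply: (subfieldX _ (sQ m)).
    by move=> Kra; apply: nKw; apply: (subfield_div (sQ m)).
  split=> // [_ e2|[_ _ _]]; last by rewrite dN.
  by case: e2; split.
have dm : (d < m)%N by rewrite -nm.
have [dN1 dN2] := degree_iterated_root two_neq0 z_prim z4_notin cases m2 dn dm b_ind rb2 rNab.
rewrite -/Km -/deg_Na in dN1 dN2.
(* Raising once more to the square removes the sign: [ra] is a 2^(n+1)-th root of b^(2^(d+1)). The
   difference of exponents is still n - d >= 2, so both degrees agree and exceed 1. *)
have [d2n|d1n] := ltnP d.+1 n.
  have ra2 : ra ^+ (2 ^ n.+1) = iota b ^+ (2 ^ d.+1).
    by rewrite raE exprMn w_unity mul1r !expnSr !exprM rNab.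
  have d1m : (d.+1 < m)%N by rewrite -nm.
  have [] := degree_iterated_root two_neq0 z_prim z4_notin cases m2
    (N := n.+1) (D := d.+1) (leqW d2n) d1m b_ind rb2 ra2.
  rewrite -/Km -/deg_a subSS => da1 da2.
  have dE : deg_a = deg_Na.
    by have [Krb|Krb] := pselect (Km rb); [rewrite da1 ?dN1|rewrite da2 ?dN2].
  have dNn1 : deg_Na <> 1%N.
    have [Krb|Krb] := pselect (Km rb); [rewrite dN1 //|rewrite dN2 //];
      by move/eqP; rewrite (eqn_exp2l _ 0) //; lia.
  split=> // [[_ _ _ /dNn1]|[_ _ [_ nE sd] _]] //; lia.
have {d1n}nd1 : n = d.+1 by lia.
have nd1E : (n - d)%N = 1%N by rewrite nd1 subSnn.
rewrite nd1E /= in dN1 dN2.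
have rb0 : rb != 0.
  by apply: contraNneq b0 => rb0; rewrite -rb2 rb0 expr0n.
(* With n = d + 1, the 2^n-th power of sqrt b is -a, so v is again a primitive 2^(n+1)-th root of
   unity. *)
pose v := ra / rb; have vE : ra = v * rb by rewrite divfK.
have vn : v ^+ (2 ^ n) = -1.
  have rbn : rb ^+ (2 ^ n) = rNa ^+ (2 ^ n) by rewrite rNab nd1 expnS exprM rb2.
  by rewrite expr_div_n rbn -expr_div_n wn.
have nKv : ~ Km v by rewrite /Km -nm; apply: (z_new two_neq0 z_prim s2 zs sn).
have Qv : cyc2 iota z n.+1 v.
  by apply: cyc2_unity => //; rewrite expnSr exprM vn sqrrN expr1n.
have Kb : Km (rb ^+ 2) by rewrite rb2; apply: cyc2_iota.
have Kra2 : Km (ra ^+ 2).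
  rewrite vE exprMn; apply: (subfieldM (sQ m)) => //.
  by rewrite /Km -nm; apply: cyc2_unity => //; rewrite exprAC vn sqrrN expr1n.
have [Krb|nKrb] := pselect (Km rb).
  have dN : deg_Na = 1%N by rewrite dN1.
  have da : deg_a = 2%N.
    by apply: degree2 => // Kra; apply: nKv; apply: (subfield_div (sQ m)).
  split=> // [_ e2|[_ _ _]]; last by rewrite dN.
  by case: e2; split.
have dN : deg_Na = 2%N by rewrite dN2.
have e2 : ~ exc2 by case=> _ _ _; rewrite dN.
(* Now sqrt b is outside K_{2^n}. If [ra] = v sqrt b is inside, sqrt b lies in K_{2^(n+1)}, and n >
   s would force it into K_{2^(s+1)}, hence into K_{2^n}. If n = s, v and sqrt b generate the same
   quadratic extension and their product falls into K_{2^n}. *)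
suff Kra : Km ra <-> adjoin K0 [set rb] `<=` Kinf /\ n = s.
  split=> // [_ _ e3|[_ Krb [_ ns _] _]]; last by apply: degree1; apply/Kra.
  rewrite dN; apply: degree2 => // /Kra[Krb ns]; apply: e3; split=> //.
  by split=> //; lia.
split=> [Kra|[/sub_Kinf[t t0 Qrb] ns]].
  have Qrb : cyc2 iota z n.+1 rb.
    have v0 : v != 0 by apply: contra_notN nKv => /eqP->; apply: (subfield0 (sQ m)).
    apply: (subfieldMl (sQ n.+1) Qv v0); rewrite -vE.
    by apply: (cyc2_le z_prim _ Kra); rewrite m_gt0 -nm leqnSn.
  split; first by apply/sub_Kinf; exists n.+1.
  apply/eqP; rewrite eqn_leq sn andbT leqNgt; apply/negP => s_lt_n.
  apply: nKrb; apply: (cyc2_le z_prim (j := s.+1)); first by rewrite -nm.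
  apply: (sqrt_in_succ two_neq0 z_prim s2 zs Qrb) => //.
  by rewrite rb2; apply: cyc2_iota.
rewrite vE /Km -nm; apply: (sqrt_mul_root two_neq0 z_prim s2 zs sn vn); rewrite ?nm //.
rewrite -nm ns; apply: (sqrt_in_succ two_neq0 z_prim s2 zs Qrb) => //.
by rewrite rb2; apply: cyc2_iota.
Qed.
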